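(* $$\frac{1}{2-2G}=\mathrm{CF}\left[3n^2+9n+7,\,-2n(n+1)^3\right],$$ where $G$ is Catalan's constant.
   Context: For sequences $(a_n)_{n\ge0}$, $(b_n)_{n\ge1}$, $\mathrm{CF}[a_n,b_n]$ denotes the continued fraction $a_0+\cfrac{b_1}{a_1+\cfrac{b_2}{a_2+\ddots}}$, whose value is $\lim_{n\to\infty}A_n/B_n$, where $A_0=1$, $A_1=a_0$, $B_0=0$, $B_1=1$, and $A_{n+1}=a_nA_n+b_nA_{n-1}$, $B_{n+1}=a_nB_n+b_nB_{n-1}$ for $n\ge1$. Catalan's constant is $G=\sum_{k=0}^\infty \frac{(-1)^k}{(2k+1)^2}$. *)

(* Defs.v *)
From Stdlib Require Import Reals.
From Coquelicot Require Import Coquelicot.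
Open Scope R_scope.

(** Convergents of the continued fraction CF[a_n, b_n].  The partial
    numerators are b_1, b_2, ...: the value [b 0] is never used.  The indexing
    is shifted by one from the common one: A_0/B_0 is the formal 1/0 and
    A_1/B_1 = a_0. *)
Fixpoint cf_num (a b : nat -> R) (n : nat) : R :=
  match n with
  | O => 1
  | S m =>
      match m with
      | O => a O
      | S k => a m * cf_num a b m + b m * cf_num a b k
      end
  end.

Fixpoint cf_den (a b : nat -> R) (n : nat) : R :=
  match n with
  | O => 0
  | S m =>
      match m with
      | O => 1
      | S k => a m * cf_den a b m + b m * cf_den a b k
      end
  end.

(** Division by zero is a total junk value in [R], so we require that the
    quotients A_n/B_n be meaningful for all large n. *)
Definition is_CF (a b : nat -> R) (x : R) : Prop :=
  eventually (fun n => cf_den a b n <> 0) /\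
  is_lim_seq (fun n => cf_num a b n / cf_den a b n) (Finite x).

Definition Catalan : R :=
  Series (fun k : nat => (-1) ^ k / (2 * INR k + 1) ^ 2).

(* Main.v *)
(** Divided by [(n+1)!^2], the recurrence of the convergents becomes
      [(n+2)^2 w_(n+1) = (3n^2+9n+7) w_n - 2n(n+1) w_(n-1)],
    whose solutions generically grow like [2^n], with a bounded exceptional one.
    The latter is an alternating hypergeometric series [sum_k (-1)^k F(n,k)]
    with [F(0,k) = 2/(2k+3)^2], so that its value at [n = 0] is [2 - 2G].
    Creative telescoping shows that it satisfies the recurrence, hence it equals
    [(A_n (2 - 2G) - B_n)/(n+1)!^2].  It is bounded because
    [0 <= F(n,k) <= F(0,k)], while [B_n/(n+1)!^2] grows at least like [(3/2)^n];
    therefore [A_n (2 - 2G)/B_n] tends to 1. *)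

Require Import Defs.
From Stdlib Require Import Reals.
From Coquelicot Require Import Coquelicot.
From Stdlib Require Import Factorial Lra Lia.
Open Scope R_scope.

(** * Telescoping series and the hypergeometric term F(n,k) *)

Lemma is_series_telescope (t : nat -> R) (l : R) :
  is_lim_seq t l -> is_series (fun k => t (S k) - t k) (l - t 0%nat).
Proof.
  intros Ht.
  change (is_lim_seq (sum_n (fun k => t (S k) - t k)) (l - t 0%nat)).
  apply (is_lim_seq_ext (fun n => t (S n) - t 0%nat)).
  - intros n; induction n as [|n IH].
    + now rewrite sum_O.
    + rewrite sum_Sn, <- IH; unfold plus; simpl; ring.
  - apply is_lim_seq_minus'; [now apply is_lim_seq_incr_1 in Ht | apply is_lim_seq_const].
Qed.

(** [ratio_n n k = F(n+1,k)/F(n,k)] and [ratio_k n k = F(n,k+1)/F(n,k)] for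
    [F(n,k) = (8/9) n! (n+2)! (n+3)_k (3/2)_k^2
              / ((5/2)_n^2 k! (n+5/2)_k^2 (n+2k+2) (n+2k+4))],
    the form given by Whipple's transformation to
    [3F2(n+1, (n+2)/2, (n+3)/2; n+5/2, n+5/2; 1)]. *)
Definition ratio_n (x y : R) : R :=
  (x + 1) * (x + 3 + y) * (x + 2 * y + 2) * (x + 2 * y + 4) /
  ((x + 5 / 2 + y) ^ 2 * (x + 2 * y + 3) * (x + 2 * y + 5)).

Definition ratio_k (x y : R) : R :=
  (x + 3 + y) * (y + 3 / 2) ^ 2 * (x + 2 * y + 2) /
  ((y + 1) * (x + 5 / 2 + y) ^ 2 * (x + 2 * y + 6)).

Fixpoint summand (n k : nat) : R :=
  match n with
  | O => 2 / (2 * INR k + 3) ^ 2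
  | S m => summand m k * ratio_n (INR m) (INR k)
  end.

Lemma ratio_n_bounds (x y : R) : 0 <= x -> 0 <= y -> 0 <= ratio_n x y <= 1.
Proof.
  intros Hx Hy; unfold ratio_n; split.
  - apply Rmult_le_pos.
    + repeat apply Rmult_le_pos; lra.
    + left; apply Rinv_0_lt_compat.
      repeat apply Rmult_lt_0_compat; lra.
  - apply Rle_div_l; [repeat apply Rmult_lt_0_compat; lra | rewrite Rmult_1_l].
    (* The factors are paired: (x+1)(x+3+y) <= (x+5/2+y)^2 and (x+2y+2)(x+2y+4) <=
       (x+2y+3)(x+2y+5). *)
    rewrite (Rmult_assoc (_ * _) (x + 2 * y + 2)), (Rmult_assoc (_ ^ 2)).
    apply Rmult_le_compat; nra.
Qed.

Lemma summand_nonneg (n k : nat) : 0 <= summand n k.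
Proof.
  induction n as [|n IH]; cbn [summand].
  - apply Rdiv_le_0_compat; [lra|]. pose proof (pos_INR k). apply pow_lt; lra.
  - apply Rmult_le_pos; [exact IH|].
    apply ratio_n_bounds; apply pos_INR.
Qed.

Lemma summand_le (n k : nat) : summand n k <= summand 0 k.
Proof.
  induction n as [|n IH]; [lra|].
  pose proof (summand_nonneg n k).
  pose proof (ratio_n_bounds (INR n) (INR k) (pos_INR n) (pos_INR k)).
  change (summand (S n) k) with (summand n k * ratio_n (INR n) (INR k)). nra.
Qed.

(** Since [summand] recurses in n only, its ratio in k is recovered by induction from ratio_k(n,k)
    ratio_n(n,k+1) = ratio_n(n,k) ratio_k(n+1,k). *)
Lemma summand_succ_r (n k : nat) :
  summand n (S k) = summand n k * ratio_k (INR n) (INR k).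
Proof.
  pose proof (pos_INR k) as Hk.
  induction n as [|n IH]; cbn [summand].
  - rewrite S_INR. unfold ratio_k; change (INR 0) with 0. field. repeat split; lra.
  - rewrite IH, !S_INR. pose proof (pos_INR n) as Hn.
    rewrite !Rmult_assoc; f_equal.
    unfold ratio_k, ratio_n. field. repeat split; lra.
Qed.

(** * Absolute convergence, uniformly in n *)

Lemma inv_succ_lim : is_lim_seq (fun k => / (INR k + 1)) 0.
Proof.
  apply (is_lim_seq_ext (fun k => / INR (S k))).
  - intros k; now rewrite S_INR.
  - apply (is_lim_seq_incr_1 (fun k => / INR k)).
    replace (Finite 0) with (Rbar_inv p_infty) by reflexivity.
    apply is_lim_seq_inv; [apply is_lim_seq_INR | discriminate].
Qed.

(** The right side is 1/((k+1)(k+2)), and (2k+3)^2 - 2(k+1)(k+2) = 2k^2+6k+5 is positive. This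
    telescoping majorant makes row 0 summable. *)
Lemma summand0_le (k : nat) : summand 0 k <= / (INR k + 1) - / (INR (S k) + 1).
Proof.
  rewrite S_INR; cbn [summand]. pose proof (pos_INR k) as Hk.
  apply Rminus_le_0.
  replace (_ - _) with
    (1 / ((INR k + 1) * (INR k + 2) * (2 * INR k + 3) ^ 2) *
     (2 * INR k ^ 2 + 6 * INR k + 5)) by (field; repeat split; lra).
  apply Rmult_le_pos; [|nra].
  apply Rdiv_le_0_compat; [lra|].
  repeat apply Rmult_lt_0_compat; lra.
Qed.

Lemma ex_series_summand0 : ex_series (summand 0).
Proof.
  apply (ex_series_le (summand 0) (fun k => - (/ (INR (S k) + 1) - / (INR k + 1)))).
  - intros k. change (Rabs (summand 0 k) <= - (/ (INR (S k) + 1) - / (INR k + 1))).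
    rewrite Rabs_pos_eq; [|apply summand_nonneg].
    pose proof (summand0_le k); lra.
  - apply (ex_series_opp (fun k => / (INR (S k) + 1) - / (INR k + 1))).
    eexists. apply (is_series_telescope (fun k => / (INR k + 1))). apply inv_succ_lim.
Qed.

Lemma summand0_lim : is_lim_seq (summand 0) 0.
Proof. apply ex_series_lim_0, ex_series_summand0. Qed.

Lemma Rabs_alt (k : nat) (x : R) : Rabs ((-1) ^ k * x) = Rabs x.
Proof. now rewrite Rabs_mult, pow_1_abs, Rmult_1_l. Qed.

Definition alt_sum (n : nat) : R := Series (fun k => (-1) ^ k * summand n k).

Lemma alt_term_le (n k : nat) : Rabs ((-1) ^ k * summand n k) <= summand 0 k.
Proof.
  rewrite Rabs_alt, Rabs_pos_eq; [apply summand_le | apply summand_nonneg].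
Qed.

Lemma ex_series_abs_alt (n : nat) : ex_series (fun k => Rabs ((-1) ^ k * summand n k)).
Proof.
  apply (ex_series_le (fun k => Rabs ((-1) ^ k * summand n k)) (summand 0)); [|apply ex_series_summand0].
  intros k. change (Rabs (Rabs ((-1) ^ k * summand n k)) <= summand 0 k).
  rewrite Rabs_Rabsolu. apply alt_term_le.
Qed.

Lemma alt_sum_correct (n : nat) : is_series (fun k => (-1) ^ k * summand n k) (alt_sum n).
Proof. apply Series_correct, ex_series_Rabs, ex_series_abs_alt. Qed.

Lemma alt_sum_bound (n : nat) : Rabs (alt_sum n) <= Series (summand 0).
Proof.
  eapply Rle_trans; [apply Series_Rabs, ex_series_abs_alt|].
  apply Series_le; [|apply ex_series_summand0].
  intros k; split; [apply Rabs_pos | apply alt_term_le].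
Qed.

(** * The two initial values *)

Lemma alt_sum_0 : alt_sum 0 = 2 - 2 * Catalan.
Proof.
  set (a := fun k : nat => (-1) ^ k / (2 * INR k + 1) ^ 2).
  (* Up to the factor -2, row 0 is Catalan's series without its first term 1; the index shift
     accounts for the sign. *)
  assert (Ha : forall k, - / 2 * ((-1) ^ k * summand 0 k) = a (S k)).
  { intros k. unfold a; cbn [summand]. pose proof (pos_INR k).
    rewrite S_INR. change ((-1) ^ S k) with (-1 * (-1) ^ k). field. lra. }
  assert (HC : Catalan = 1 - alt_sum 0 / 2).
  { change Catalan with (Series a). rewrite Series_incr_1.
    - rewrite <- (Series_ext _ _ Ha), Series_scal_l. unfold a, alt_sum; simpl; field.
    - apply ex_series_incr_1, (ex_series_ext _ _ Ha).
      apply (ex_series_scal_l (V := R_NormedModule) (- / 2)).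
      eexists; apply alt_sum_correct. }
  rewrite HC; field.
Qed.

(** The coefficients are those of [alt_sum_rec] at n = -1, where the third one vanishes. The
    antidifference [t] has t(0) = 27/27 = 1, whence the inhomogeneous term. *)
Lemma alt_sum_1 : 4 * alt_sum 1 = 7 * alt_sum 0 - 1.
Proof.
  set (t := fun k : nat => (-1) ^ k * ((14 * INR k + 27) / (2 * INR k + 3) ^ 3)).
  assert (Ht : is_lim_seq t 0).
  { apply is_lim_seq_abs_0.
    apply (is_lim_seq_le_le (fun _ => 0) _ (fun k => 27 * / (INR k + 1))).
    - intros k; split; [apply Rabs_pos|]. unfold t; rewrite Rabs_alt.
      pose proof (pos_INR k) as Hk.
      rewrite Rabs_pos_eq.
      2:{ apply Rdiv_le_0_compat; [lra | apply pow_lt; lra]. }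
      apply Rle_div_l; [apply pow_lt; lra|].
      apply Rmult_le_reg_l with (INR k + 1); [lra|].
      replace (_ * (27 * _ * _)) with (27 * (2 * INR k + 3) ^ 3)
        by (field; lra).
      nra.
    - apply is_lim_seq_const.
    - replace (Finite 0) with (Rbar_mult 27 0) by (simpl; f_equal; ring).
      apply is_lim_seq_scal_l, inv_succ_lim. }
  assert (E : 4 * alt_sum 1 - 7 * alt_sum 0 = 0 - t 0%nat).
  { rewrite <- (is_series_unique _ _ (is_series_telescope t 0 Ht)).
    symmetry; apply is_series_unique.
    eapply is_series_ext;
      [|exact (is_series_minus (V := R_NormedModule) _ _ _ _
          (is_series_scal_l (V := R_NormedModule) 4 _ _ (alt_sum_correct 1))
          (is_series_scal_l (V := R_NormedModule) 7 _ _ (alt_sum_correct 0)))].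
    intros k; unfold t, minus, plus, opp, scal, mult; cbn -[INR pow].
    rewrite S_INR; unfold ratio_n; change (INR 0) with 0; pose proof (pos_INR k).
    change ((-1) ^ S k) with (-1 * (-1) ^ k). field. repeat split; lra. }
  unfold t in E; simpl in E; lra.
Qed.

(** * The three-term recurrence by creative telescoping *)

(** Zeilberger certificate: the recurrence applied to [(-1)^k F(n,k)] is the
    difference in [k] of [(-1)^k F(n,k) cert(n,k)]. *)
Definition cert (x y : R) : R :=
  y * ((16 - 16 * x - 103 * x ^ 2 - 229 / 2 * x ^ 3 - 109 / 2 * x ^ 4 - 12 * x ^ 5 - x ^ 6)
    - (64 + 284 * x + 409 * x ^ 2 + 251 * x ^ 3 + 69 * x ^ 4 + 7 * x ^ 5) * y
    - (156 + 406 * x + 370 * x ^ 2 + 138 * x ^ 3 + 18 * x ^ 4) * y ^ 2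
    - (92 + 180 * x + 108 * x ^ 2 + 20 * x ^ 3) * y ^ 3
    - (16 + 24 * x + 8 * x ^ 2) * y ^ 4) /
  ((x + 5 / 2 + y) ^ 2 * (x + 2 * y + 2) * (x + 2 * y + 3) * (x + 2 * y + 4)).

(** Numerator and denominator both have degree 5 in y, and the denominator is at least (1+y)^5.
    Boundedness makes the telescoped term vanish as k grows. *)
Lemma cert_bounded (x : R) : 0 <= x -> exists M, forall y, 0 <= y -> Rabs (cert x y) <= M.
Proof.
  intros Hx. unfold cert.
  set (c0 := 16 - 16 * x - _ - _ - _ - _ - _).
  set (c1 := 64 + _ + _ + _ + _ + _). set (c2 := 156 + _ + _ + _ + _).
  set (c3 := 92 + _ + _ + _). set (c4 := 16 + _ + _).
  exists (Rabs c0 + Rabs c1 + Rabs c2 + Rabs c3 + Rabs c4). intros y Hy.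
  set (D := (x + 5 / 2 + y) ^ 2 * (x + 2 * y + 2) * (x + 2 * y + 3) * (x + 2 * y + 4)).
  assert (HD : (1 + y) ^ 5 <= D).
  { replace ((1 + y) ^ 5) with ((1 + y) ^ 2 * (1 + y) * (1 + y) * (1 + y)) by ring.
    unfold D. repeat apply Rmult_le_compat; try (apply pow_incr); try lra;
      repeat apply Rmult_le_pos; try apply pow_le; lra. }
  assert (HD0 : 0 < D) by (eapply Rlt_le_trans; [apply pow_lt | exact HD]; lra).
  assert (Hpow : forall j, (j <= 4)%nat -> y * y ^ j <= D).
  { intros j Hj. eapply Rle_trans; [|exact HD].
    change (y * y ^ j) with (y ^ S j).
    apply Rle_trans with ((1 + y) ^ S j); [apply pow_incr; lra|].
    apply Rle_pow; [lra|lia]. }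
  unfold Rdiv. rewrite Rabs_mult, Rabs_inv, (Rabs_pos_eq D) by lra.
  apply Rle_div_l; [lra|].
  assert (Hterm : forall c j, (j <= 4)%nat -> Rabs (c * (y * y ^ j)) <= Rabs c * D).
  { intros c j Hj. rewrite Rabs_mult. apply Rmult_le_compat_l; [apply Rabs_pos|].
    rewrite Rabs_pos_eq; [now apply Hpow|]. apply Rmult_le_pos, pow_le; lra. }
  replace (y * _) with (c0 * (y * y ^ 0) + - (c1 * (y * y ^ 1)) + - (c2 * (y * y ^ 2))
    + - (c3 * (y * y ^ 3)) + - (c4 * (y * y ^ 4))) by ring.
  rewrite !Rmult_plus_distr_r.
  repeat (eapply Rle_trans; [apply Rabs_triang|]; apply Rplus_le_compat);
    rewrite ?Rabs_Ropp; apply Hterm; lia.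
Qed.

(** The telescoping relation divided by (-1)^k F(n,k); the sign before [ratio_k] comes from
    (-1)^(k+1). *)
Lemma cert_identity (x y : R) : 0 <= x -> 0 <= y ->
  (x + 3) ^ 2 * (ratio_n x y * ratio_n (x + 1) y)
  - (3 * (x + 1) ^ 2 + 9 * (x + 1) + 7) * ratio_n x y + 2 * (x + 1) * (x + 2)
  = - ratio_k x y * cert x (y + 1) - cert x y.
Proof.
  intros Hx Hy. unfold ratio_n, ratio_k, cert. field. repeat split; lra.
Qed.

Lemma alt_sum_rec (n : nat) :
  (INR n + 3) ^ 2 * alt_sum (S (S n)) =
  (3 * (INR n + 1) ^ 2 + 9 * (INR n + 1) + 7) * alt_sum (S n)
  - 2 * (INR n + 1) * (INR n + 2) * alt_sum n.
Proof.
  set (t := fun k : nat => (-1) ^ k * (summand n k * cert (INR n) (INR k))).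
  assert (Ht : is_lim_seq t 0).
  { destruct (cert_bounded (INR n) (pos_INR n)) as [M HM].
    apply is_lim_seq_abs_0.
    apply (is_lim_seq_le_le (fun _ => 0) _ (fun k => M * summand 0 k)).
    - intros k; split; [apply Rabs_pos|]. unfold t; rewrite Rabs_alt, Rabs_mult, Rmult_comm.
      apply Rmult_le_compat; try apply Rabs_pos; [apply HM, pos_INR|].
      rewrite Rabs_pos_eq; [apply summand_le | apply summand_nonneg].
    - apply is_lim_seq_const.
    - replace (Finite 0) with (Rbar_mult M 0) by (simpl; f_equal; ring).
      apply is_lim_seq_scal_l, summand0_lim. }
  assert (E : (INR n + 3) ^ 2 * alt_sum (S (S n))
     - (3 * (INR n + 1) ^ 2 + 9 * (INR n + 1) + 7) * alt_sum (S n)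
     + 2 * (INR n + 1) * (INR n + 2) * alt_sum n = 0 - t 0%nat).
  { rewrite <- (is_series_unique _ _ (is_series_telescope t 0 Ht)).
    symmetry; apply is_series_unique.
    eapply is_series_ext;
      [|exact (is_series_plus (V := R_NormedModule) _ _ _ _
          (is_series_minus (V := R_NormedModule) _ _ _ _
            (is_series_scal_l (V := R_NormedModule) _ _ _ (alt_sum_correct (S (S n))))
            (is_series_scal_l (V := R_NormedModule) _ _ _ (alt_sum_correct (S n))))
          (is_series_scal_l (V := R_NormedModule) _ _ _ (alt_sum_correct n)))].
    intros k; unfold t, minus, plus, opp, scal, mult; cbn -[INR pow summand].
    rewrite summand_succ_r.
    change (summand (S (S n)) k)
      with (summand n k * ratio_n (INR n) (INR k) * ratio_n (INR (S n)) (INR k)).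
    change (summand (S n) k) with (summand n k * ratio_n (INR n) (INR k)).
    change ((-1) ^ S k) with (-1 * (-1) ^ k).
    pose proof (cert_identity (INR n) (INR k) (pos_INR n) (pos_INR k)) as Hc.
    rewrite !S_INR.
    transitivity ((-1) ^ k * summand n k *
      (- ratio_k (INR n) (INR k) * cert (INR n) (INR k + 1) - cert (INR n) (INR k)));
      [rewrite <- Hc|]; ring. }
  (* The factor y of [cert] kills the boundary term, so the recurrence is homogeneous. *)
  assert (Z : t 0%nat = 0).
  { unfold t, cert. change (INR 0) with 0. unfold Rdiv. ring. }
  lra.
Qed.

(** * The remainder and the growth of the denominators *)

Definition cf_a (n : nat) : R := 3 * INR n ^ 2 + 9 * INR n + 7.
Definition cf_b (n : nat) : R := - 2 * INR n * (INR n + 1) ^ 3.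
Definition weight (n : nat) : R := INR (fact (S n)) ^ 2.

Lemma weight_pos (n : nat) : 0 < weight n.
Proof. apply pow_lt, INR_fact_lt_0. Qed.

Lemma weight_succ (n : nat) : weight (S n) = (INR n + 2) ^ 2 * weight n.
Proof.
  unfold weight. change (fact (S (S n))) with ((S (S n)) * fact (S n))%nat.
  rewrite mult_INR, !S_INR. ring.
Qed.

Lemma cf_num_rec (a b : nat -> R) (n : nat) :
  cf_num a b (S (S n)) = a (S n) * cf_num a b (S n) + b (S n) * cf_num a b n.
Proof. reflexivity. Qed.

Lemma cf_den_rec (a b : nat -> R) (n : nat) :
  cf_den a b (S (S n)) = a (S n) * cf_den a b (S n) + b (S n) * cf_den a b n.
Proof. reflexivity. Qed.

(** Both sides satisfy the same second-order recurrence, so the induction carries two consecutive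
    indices; [alt_sum_1] is the case n = 1. *)
Lemma remainder_eq (n : nat) :
  cf_num cf_a cf_b n * (2 - 2 * Catalan) - cf_den cf_a cf_b n = weight n * alt_sum n.
Proof.
  rewrite <- alt_sum_0.
  enough (H : forall m,
    cf_num cf_a cf_b m * alt_sum 0 - cf_den cf_a cf_b m = weight m * alt_sum m /\
    cf_num cf_a cf_b (S m) * alt_sum 0 - cf_den cf_a cf_b (S m)
      = weight (S m) * alt_sum (S m)) by apply H.
  intros m; induction m as [|m [IH0 IH1]].
  - pose proof alt_sum_1. unfold weight, cf_a; simpl. split; lra.
  - split; [exact IH1|].
    rewrite cf_num_rec, cf_den_rec.
    transitivity (cf_a (S m) * (weight (S m) * alt_sum (S m))
      + cf_b (S m) * (weight m * alt_sum m)); [rewrite <- IH0, <- IH1; ring|].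
    rewrite !weight_succ. unfold cf_a, cf_b. rewrite !S_INR.
    transitivity ((INR m + 2) ^ 2 * weight m * ((INR m + 3) ^ 2 * alt_sum (S (S m))));
      [rewrite alt_sum_rec|]; ring.
Qed.

(** A growth factor r propagates to leading order when 3 - 2/r >= r, that is 1 <= r <= 2; 3/2 leaves
    slack on both sides. *)
Lemma cf_den_growth (n : nat) :
  0 <= cf_den cf_a cf_b n /\
  3 / 2 * (INR n + 2) ^ 2 * cf_den cf_a cf_b n <= cf_den cf_a cf_b (S n).
Proof.
  induction n as [|n [IH0 IH1]]; [simpl; lra|].
  pose proof (pos_INR n) as Hn.
  set (u := cf_den cf_a cf_b n) in *.
  assert (H1 : 0 <= cf_den cf_a cf_b (S n)) by nra.
  split; [exact H1|].
  rewrite cf_den_rec; fold u.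
  set (v := cf_den cf_a cf_b (S n)) in *.
  unfold cf_a, cf_b; rewrite !S_INR.
  set (x := INR n) in *.
  (* This bounds the negative term by (4/3)(x+1)(x+2)v; what remains to check is (x^2/6 + 2x +
     17/6)v >= 0. *)
  assert (H2 : 2 * (x + 1) * (x + 2) * (3 / 2 * (x + 2) ^ 2 * u)
               <= 2 * (x + 1) * (x + 2) * v).
  { apply Rmult_le_compat_l; [nra | exact IH1]. }
  assert (H3 : 0 <= x ^ 2 * v) by nra.
  assert (H4 : 0 <= x * v) by nra.
  nra.
Qed.

(** Iterates the growth from B_1 = 1, as B_0 = 0; the constant 1/4 is 1/[weight 1]. *)
Lemma cf_den_lower (n : nat) :
  / 4 * (3 / 2) ^ n * weight (S n) <= cf_den cf_a cf_b (S n).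
Proof.
  induction n as [|n IH]; [unfold weight; simpl; lra|].
  eapply Rle_trans; [|apply cf_den_growth].
  rewrite weight_succ, S_INR. simpl pow.
  set (p := (3/2)^n) in *. set (w := weight (S n)) in *.
  pose proof (pos_INR n).
  replace (/ 4 * (3 / 2 * p) * _) with
    (3 / 2 * (INR n + 1 + 2) ^ 2 * (/ 4 * p * w)) by (simpl; ring).
  apply Rmult_le_compat_l; [nra | exact IH].
Qed.

Lemma cf_den_pos (n : nat) : 0 < cf_den cf_a cf_b (S n).
Proof.
  eapply Rlt_le_trans; [|apply cf_den_lower].
  apply Rmult_lt_0_compat; [|apply weight_pos].
  apply Rmult_lt_0_compat; [lra | apply pow_lt; lra].
Qed.

(** * Passage to the limit *)

Lemma remainder_lim :
  is_lim_seq (fun n => weight (S n) * alt_sum (S n) / cf_den cf_a cf_b (S n)) 0.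
Proof.
  set (C := Series (summand 0)).
  apply is_lim_seq_abs_0.
  apply (is_lim_seq_le_le (fun _ => 0) _ (fun n => 4 * C * (2 / 3) ^ n)).
  - intros n; split; [apply Rabs_pos|].
    pose proof (cf_den_pos n) as Hd. pose proof (weight_pos (S n)) as Hw.
    unfold Rdiv; rewrite !Rabs_mult, Rabs_inv, (Rabs_pos_eq (weight _)),
      (Rabs_pos_eq (cf_den _ _ _)) by lra.
    apply Rle_div_l; [exact Hd|].
    pose proof (alt_sum_bound (S n)) as HC; fold C in HC.
    assert (HC0 : 0 <= C) by (pose proof (Rabs_pos (alt_sum (S n))); lra).
    apply Rle_trans with (4 * C * (2 / 3) ^ n * (/ 4 * (3 / 2) ^ n * weight (S n))).
    + replace (4 * C * _ * _) with (((2 / 3) ^ n * (3 / 2) ^ n) * (weight (S n) * C))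
        by field.
      rewrite <- Rpow_mult_distr. replace (2 / 3 * (3 / 2)) with 1 by field.
      rewrite pow1, Rmult_1_l. apply Rmult_le_compat_l; lra.
    + apply Rmult_le_compat_l; [|apply cf_den_lower].
      apply Rmult_le_pos; [lra | apply pow_le; lra].
  - apply is_lim_seq_const.
  - replace (Finite 0) with (Rbar_mult (4 * C) 0) by (simpl; f_equal; ring).
    apply is_lim_seq_scal_l, is_lim_seq_geom. rewrite Rabs_pos_eq; lra.
Qed.

Theorem corollary2p9 :
  is_CF (fun n : nat => 3 * INR n ^ 2 + 9 * INR n + 7)
        (fun n : nat => - 2 * INR n * (INR n + 1) ^ 3)
        (1 / (2 - 2 * Catalan)).
Proof.
  change (is_CF cf_a cf_b (1 / (2 - 2 * Catalan))).
  set (x := 2 - 2 * Catalan).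
  assert (Hlim : is_lim_seq
    (fun n => cf_num cf_a cf_b (S n) / cf_den cf_a cf_b (S n) * x) 1).
  { apply (is_lim_seq_ext
      (fun n => 1 + weight (S n) * alt_sum (S n) / cf_den cf_a cf_b (S n))).
    - intros n. pose proof (cf_den_pos n).
      rewrite <- remainder_eq; fold x. field. lra.
    - replace (Finite 1) with (Finite (1 + 0)) by (f_equal; ring).
      apply is_lim_seq_plus'; [apply is_lim_seq_const | apply remainder_lim]. }
  (* Were x zero, the sequence in [Hlim] would be constantly 0 and yet tend to 1. *)
  assert (Hx : x <> 0).
  { intros Hx. rewrite Hx in Hlim.
    apply (is_lim_seq_ext _ (fun _ => 0)) in Hlim; [|intros n; ring].
    apply is_lim_seq_unique in Hlim. rewrite Lim_seq_const in Hlim.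
    injection Hlim; lra. }
  split.
  - exists 1%nat. intros [|n] Hn; [lia|].
    pose proof (cf_den_pos n); lra.
  - apply is_lim_seq_incr_1.
    apply (is_lim_seq_ext
      (fun n => cf_num cf_a cf_b (S n) / cf_den cf_a cf_b (S n) * x * / x)).
    + intros n. field. pose proof (cf_den_pos n). split; lra.
    + replace (Finite (1 / x)) with (Rbar_mult 1 (/ x))
        by (simpl; f_equal; field; exact Hx).
      now apply is_lim_seq_scal_r.
Qed.
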